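(* Let $b\colon E_1\times E_2\to F$ be a continuous bilinear map between locally convex spaces with $b\neq 0$. If $G$ is an infinite discrete group, then the map $$\beta\colon E_1^{(G)}\times E_2^{(G)}\to F^{(G)},\quad\beta(\gamma,\eta):=\gamma*_b\eta$$ is continuous if and only if $G$ is countable and $b$ admits product estimates.
   Context: Locally convex spaces are Hausdorff real locally convex topological vector spaces. For a locally convex space $H$, $H^{(G)}:=\bigoplus_{g\in G}H$ is the space of finitely supported functions $G\to H$, with the locally convex direct sum topology. For $\gamma\in E_1^{(G)}$, $\eta\in E_2^{(G)}$, $(\gamma*_b\eta)(x):=\int_G b(\gamma(y),\eta(y^{-1}x))\,d\lambda_G(y)$ for $x\in G$, where $\lambda_G$ is a Haar measure on the discrete group $G$, i.e. a positive multiple of counting measure (so the integral is, up to that factor, the finite sum $\sum_{y\in G}b(\gamma(y),\eta(y^{-1}x))$). No completeness assumption on $F$ is made. $b$ admits product estimates if for each double sequence $(p_{i,j})_{i,j\in\mathbb{N}}$ of continuous seminorms on $F$ there exist a sequence $(p_i)_{i\in\mathbb{N}}$ of continuous seminorms on $E_1$ and a sequence $(q_j)_{j\in\mathbb{N}}$ of continuous seminorms on $E_2$ such that $p_{i,j}(b(x,y))\leq p_i(x)q_j(y)$ for all $i,j\in\mathbb{N}$, $x\in E_1$, $y\in E_2$. *)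

(* Defs.v *)
From HB Require Import structures.
From mathcomp Require Import all_boot all_order all_algebra finmap.
From mathcomp Require Import all_classical all_reals all_analysis.
Import Order.TTheory GRing.Theory Num.Theory.
Import numFieldNormedType.Exports.

Set Implicit Arguments.
Unset Strict Implicit.
Unset Printing Implicit Defensive.

Local Open Scope classical_set_scope.
Local Open Scope ring_scope.

(* E^(G): the finitely supported functions from G to E. *)
Definition dsum (G : choiceType) (E : zmodType) := {fsfun G -> E with 0}.

HB.instance Definition _ G E := Choice.on (dsum G E).

Section DsumZmod.
Context (G : choiceType) (E : zmodType).
Implicit Types u v w : dsum G E.

Definition dsum_zero : dsum G E := [fsfun with 0].
Definition dsum_add u v : dsum G E :=
  [fsfun g in (finsupp u `|` finsupp v)%fset => u g + v g].
Definition dsum_opp u : dsum G E := [fsfun g in finsupp u => - u g].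

Lemma dsum_zeroE g : dsum_zero g = 0.
Proof. by rewrite fsfunE. Qed.

Lemma dsum_addE u v g : dsum_add u v g = u g + v g.
Proof.
rewrite fsfunE in_fsetU; case: ifPn => //; rewrite negb_or => /andP[gu gv].
by rewrite !fsfun_dflt// addr0.
Qed.

Lemma dsum_oppE u g : dsum_opp u g = - u g.
Proof. by rewrite fsfunE; case: ifPn => // gu; rewrite fsfun_dflt// oppr0. Qed.

Lemma dsum_addA : associative dsum_add.
Proof. by move=> u v w; apply/fsfunP => g; rewrite !dsum_addE addrA. Qed.

Lemma dsum_addC : commutative dsum_add.
Proof. by move=> u v; apply/fsfunP => g; rewrite !dsum_addE addrC. Qed.

Lemma dsum_add0 : left_id dsum_zero dsum_add.
Proof. by move=> u; apply/fsfunP => g; rewrite dsum_addE dsum_zeroE add0r. Qed.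

Lemma dsum_addN : left_inverse dsum_zero dsum_opp dsum_add.
Proof.
by move=> u; apply/fsfunP => g; rewrite dsum_addE dsum_oppE dsum_zeroE addNr.
Qed.

HB.instance Definition _ := GRing.isZmodule.Build (dsum G E)
  dsum_addA dsum_addC dsum_add0 dsum_addN.

Lemma dsum0E g : (0 : dsum G E) g = 0. Proof. exact: dsum_zeroE. Qed.
Lemma dsumDE u v g : (u + v) g = u g + v g. Proof. exact: dsum_addE. Qed.
Lemma dsumNE u g : (- u) g = - u g. Proof. exact: dsum_oppE. Qed.

(* The inclusion of the summand of index g. *)
Definition dsum_in (g : G) (e : E) : dsum G E := [fsfun _ in [fset g]%fset => e].

Lemma dsum_inE g e h : dsum_in g e h = if h == g then e else 0.
Proof. by rewrite fsfunE in_fset1. Qed.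

Lemma dsum_in0 g : dsum_in g 0 = 0.
Proof. by apply/fsfunP => h; rewrite dsum_inE dsum0E if_same. Qed.

Lemma dsum_inD g e e' : dsum_in g (e + e') = dsum_in g e + dsum_in g e'.
Proof.
by apply/fsfunP => h; rewrite dsumDE !dsum_inE; case: ifP; rewrite ?addr0.
Qed.

Lemma dsum_sumE (I : Type) (r : seq I) (F : I -> dsum G E) h :
  (\sum_(i <- r) F i) h = \sum_(i <- r) F i h.
Proof. by elim/big_rec2: _ => [|i x y _ <-]; rewrite ?dsum0E ?dsumDE. Qed.

Lemma dsum_decomp u : u = \sum_(g <- finsupp u) dsum_in g (u g).
Proof.
apply/fsfunP => h; rewrite dsum_sumE.
have [hu|hu] := finsuppP u h.
  rewrite big1_seq// => g /andP[_ gu]; rewrite dsum_inE; case: eqP => // hg.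
  by rewrite hg gu in hu.
rewrite (bigD1_seq h)//= dsum_inE eqxx big1 ?addr0// => g gh.
by rewrite dsum_inE eq_sym (negPf gh).
Qed.

End DsumZmod.

Section DsumLmod.
Context (R : pzRingType) (G : choiceType) (E : lmodType R).
Implicit Types u v : dsum G E.

Definition dsum_scale (a : R) u : dsum G E := [fsfun g in finsupp u => a *: u g].

Lemma dsum_scaleE a u g : dsum_scale a u g = a *: u g.
Proof. by rewrite fsfunE; case: ifPn => // gu; rewrite fsfun_dflt// scaler0. Qed.

Lemma dsum_scaleA a b u : dsum_scale a (dsum_scale b u) = dsum_scale (a * b) u.
Proof. by apply/fsfunP => g; rewrite !dsum_scaleE scalerA. Qed.

Lemma dsum_scale1 : left_id 1 dsum_scale.
Proof. by move=> u; apply/fsfunP => g; rewrite dsum_scaleE scale1r. Qed.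

Lemma dsum_scaleDr : right_distributive dsum_scale +%R.
Proof.
by move=> a u v; apply/fsfunP => g; rewrite dsumDE !dsum_scaleE dsumDE scalerDr.
Qed.

Lemma dsum_scaleDl u : {morph dsum_scale^~ u : a b / a + b}.
Proof.
by move=> a b; apply/fsfunP => g; rewrite dsumDE !dsum_scaleE scalerDl.
Qed.

HB.instance Definition _ := GRing.Zmodule_isLmodule.Build R (dsum G E)
  dsum_scaleA dsum_scale1 dsum_scaleDr dsum_scaleDl.

Lemma dsumZE a u g : (a *: u) g = a *: u g. Proof. exact: dsum_scaleE. Qed.

Lemma dsum_inZ g a (e : E) : dsum_in g (a *: e) = a *: dsum_in g e.
Proof.
by apply/fsfunP => h; rewrite dsumZE !dsum_inE; case: ifP; rewrite ?scaler0.
Qed.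

End DsumLmod.

Lemma convex_setP (R : numDomainType) (M : lmodType R) (A : set M) :
  @convex_set R M A <->
  forall x y t, 0 <= t -> t <= 1 -> A x -> A y -> A (t *: x + (1 - t) *: y).
Proof.
split=> [cA x y t t0 t1 Ax Ay|cA x y t /set_mem Ax /set_mem Ay].
  apply/set_mem; exact: (cA x y (Itv01 t0 t1) (mem_set Ax) (mem_set Ay)).
by apply/mem_set/cA.
Qed.

Section DsumTopology.
Context (R : realType) (G : choiceType) (E : tvsType R).
Implicit Types (u v : dsum G E) (V W : set (dsum G E)).

(* The convex sets which are neighbourhoods of 0 on every summand form a base
   of neighbourhoods of 0 for the finest locally convex vector topology making
   all the inclusions continuous (see dsum_in_continuous and
   dsum_linear_continuous below). *)
Definition dsum_nbhs0 V :=
  @convex_set R (dsum G E) V /\ V 0 /\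
  forall g, nbhs (0 : E) (dsum_in g @^-1` V).

Definition dsum_nbhs (u : dsum G E) : set_system (dsum G E) :=
  [set A | exists2 V, dsum_nbhs0 V & forall v, V v -> A (u + v)].

HB.instance Definition _ := hasNbhs.Build (dsum G E) dsum_nbhs.

Lemma dsum_nbhs0T : dsum_nbhs0 setT.
Proof.
by split; [apply/convex_setP|split=> // g; rewrite preimage_setT; exact: filterT].
Qed.

Lemma dsum_nbhs0I V W : dsum_nbhs0 V -> dsum_nbhs0 W -> dsum_nbhs0 (V `&` W).
Proof.
move=> [/convex_setP cV [V0 nV]] [/convex_setP cW [W0 nW]]; split; [|split=> //].
  by apply/convex_setP => x y t t0 t1 [Vx Wx] [Vy Wy]; split; [exact: cV|exact: cW].
by move=> g; rewrite preimage_setI; exact: filterI.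
Qed.

Lemma dsum_nbhs0Z V (a : R) : a != 0 -> dsum_nbhs0 V ->
  dsum_nbhs0 [set u | V (a *: u)].
Proof.
move=> a0 [/convex_setP cV [V0 nV]]; split; [|split].
- apply/convex_setP => x y t t0 t1 /= Vx Vy; rewrite scalerDr !scalerA.
  by rewrite ![a * _]mulrC -!scalerA; exact: cV.
- by rewrite /= scaler0.
- move=> g; have /= := @scale_continuous R E (a, 0); rewrite /continuous_at /=.
  rewrite scaler0 => /(_ _ (nV g)) [[A B] /= [nA nB] AB].
  apply: filterS nB => e Be /=; rewrite -dsum_inZ; apply: (AB (a, e)); split=> //.
  exact: nbhs_singleton nA.
Qed.

Lemma dsum_nbhs0M2 V : dsum_nbhs0 V -> dsum_nbhs0 [set u | V (2 *: u)].
Proof. by apply: dsum_nbhs0Z; rewrite pnatr_eq0. Qed.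

Lemma dsum_half V u v : dsum_nbhs0 V -> V (2 *: u) -> V (2 *: v) -> V (u + v).
Proof.
move=> [/convex_setP cV _] Vu Vv.
have := cV _ _ 2^-1 _ _ Vu Vv.
have -> : 1 - 2^-1 = 2^-1 :> R by rewrite [X in X - _](splitr 1) mul1r addrK.
rewrite !scalerA mulVf// !scale1r; apply; first by rewrite invr_ge0.
by rewrite invf_le1// ler1n.
Qed.

Lemma dsum_nbhs_proper u : ProperFilter (nbhs u).
Proof.
apply: Build_ProperFilter_ex => [A [V [_ [V0 _]] VA]|].
  by exists u; have := VA _ V0; rewrite addr0.
split.
- by exists setT => //; exact: dsum_nbhs0T.
- move=> A B [V nV VA] [W nW WB]; exists (V `&` W); first exact: dsum_nbhs0I.
  by move=> v [Vv Wv]; split; [exact: VA|exact: WB].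
- by move=> A B AB [V nV VA]; exists V => // v /VA /AB.
Qed.

Lemma dsum_nbhs_singleton u (A : set (dsum G E)) : nbhs u A -> A u.
Proof. by move=> [V [_ [V0 _]] VA]; have := VA _ V0; rewrite addr0. Qed.

Lemma dsum_nbhs_nbhs u (A : set (dsum G E)) : nbhs u A -> nbhs u (nbhs^~ A).
Proof.
move=> [V nV VA]; have nV2 : dsum_nbhs0 [set u | V (2 *: u)] by exact: dsum_nbhs0M2.
exists [set u | V (2 *: u)] => // v Vv; exists [set u | V (2 *: u)] => // w Vw.
by rewrite -addrA; apply: VA; exact: dsum_half.
Qed.

HB.instance Definition _ := Nbhs_isNbhsTopological.Build (dsum G E)
  dsum_nbhs_proper dsum_nbhs_singleton dsum_nbhs_nbhs.

Lemma dsum_add_continuous :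
  continuous (fun x : dsum G E * dsum G E => x.1 + x.2).
Proof.
move=> [u v] A /= [V nV VA].
have nV2 : dsum_nbhs0 [set u | V (2 *: u)] by exact: dsum_nbhs0M2.
exists (+%R u @` [set u | V (2 *: u)], +%R v @` [set u | V (2 *: u)]) => /=.
  by split; exists [set u | V (2 *: u)] => // w Vw; exists w.
move=> [_ _] /= [[u' Vu' <-] [v' Vv' <-]].
by rewrite addrACA; apply: VA; exact: dsum_half.
Qed.

Lemma dsum_absorb u V : dsum_nbhs0 V -> \forall t \near (0 : R^o), V (t *: u).
Proof.
rewrite (dsum_decomp u) => nV; elim/big_rec: _ V nV => [|g x _ IH] V nV.
  by near=> t; rewrite scaler0; case: nV => _ [].
have {}IH := IH _ (dsum_nbhs0M2 nV).
have [_ [_ nV2]] := dsum_nbhs0M2 nV.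
have : \forall t \near (0 : R^o), V (2 *: dsum_in g (t *: u g)).
  have /= := @scale_continuous R E (0, u g); rewrite /continuous_at /=.
  rewrite scale0r => /(_ _ (nV2 g)) [[A B] /= [nA nB] AB].
  apply: filterS nA => t At /=; apply: (AB (t, u g)); split=> //.
  exact: nbhs_singleton nB.
move: IH; apply: filterS2 => t /= Vx Vg.
by rewrite scalerDr -dsum_inZ; exact: dsum_half.
Unshelve. all: by end_near. Qed.

Lemma dsum_nbhs0_balanced V : dsum_nbhs0 V -> exists2 W, dsum_nbhs0 W &
  forall (a : R) u, `|a| <= 1 -> W u -> V (a *: u).
Proof.
move=> nV; exists (V `&` [set u | V (-1 *: u)]).
  by apply: dsum_nbhs0I => //; apply: dsum_nbhs0Z => //; rewrite oppr_eq0 oner_eq0.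
case: nV => /convex_setP cV [V0 _] a u a1 [Vu /= VNu].
have [a0|a0] := leP 0 a.
  have := cV _ _ a a0 _ Vu V0; rewrite scaler0 addr0; apply.
  by rewrite -(ger0_norm a0).
have := cV _ _ (- a) _ _ VNu V0.
rewrite scaler0 addr0 scalerA mulrN1 opprK; apply; first by rewrite oppr_ge0 ltW.
by rewrite -(ltr0_norm a0).
Qed.

Lemma dsum_scale_continuous :
  continuous (fun z : R^o * dsum G E => z.1 *: z.2).
Proof.
move=> [r u] A /= [V nV VA].
have nV2 := dsum_nbhs0M2 nV.
have [W nW WV] := dsum_nbhs0_balanced nV2.
pose c : R := `|r| + 1.
have c0 : 0 < c by rewrite ltr_wpDl.
have nWc := @dsum_nbhs0Z W c (lt0r_neq0 c0) nW.
exists ([set a : R^o | V (2 *: ((a - r) *: u))] `&` [set a : R^o | `|r - a| < 1],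
        +%R u @` [set v | W (c *: v)]) => /=.
  split; last by exists [set v | W (c *: v)] => // w Ww; exists w.
  apply: filterI; last first.
    by apply/nbhs_ballP; exists 1 => //=; move=> a.
  have := dsum_absorb u nV2; rewrite -(subrr (r : R^o)) => h.
  have /= : (fun a : R^o => a - r) @ (r : R^o) --> (r - r : R^o).
    by apply: cvgB => //; exact: cvg_cst.
  by move=> /(_ _ h).
move=> [a _] /= [[Va ar] [v Wv <-]].
have -> : a *: (u + v) = r *: u + ((a - r) *: u + a *: v).
  by rewrite scalerDr addrA -scalerDl addrCA subrr addr0.
apply: VA; apply: dsum_half => //.
have -> : a *: v = (a / c) *: (c *: v) by rewrite scalerA divfK// lt0r_neq0.
apply: WV => //; rewrite normrM normfV (gtr0_norm c0) ler_pdivrMr// mul1r.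
rewrite -[a](subrK r) (le_trans (ler_normD _ _))// addrC lerD2l.
by rewrite distrC ltW.
Qed.

Lemma dsum_locally_convex : exists2 B : set_system (dsum G E),
  (forall b, b \in B -> @convex_set R (dsum G E) b) & basis B.
Proof.
exists [set b | open b /\ @convex_set R (dsum G E) b].
  by move=> b /set_mem[].
split=> [b []//|x A [V nV VA]].
exists [set y | nbhs y [set x + v | v in V]]; last first.
  by move=> y /dsum_nbhs_singleton [v Vv <-]; exact: VA.
split; last by exists V => // v Vv; exists v.
split; first by rewrite openE => y; exact: dsum_nbhs_nbhs.
apply/convex_setP => y z t t0 t1 [V1 nV1 V1y] [V2 nV2 V2z].
exists (V1 `&` V2) => [|v [V1v V2v]]; first exact: dsum_nbhs0I.
have [y' Vy' y'E] := V1y _ V1v; have [z' Vz' z'E] := V2z _ V2v.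
exists (t *: y' + (1 - t) *: z').
  by case: nV => /convex_setP cV _; exact: cV.
have xE w : w = t *: w + (1 - t) *: w :> dsum G E.
  by rewrite -scalerDl addrC subrK scale1r.
rewrite [in LHS](xE x) [in RHS](xE v) addrACA -!scalerDr y'E z'E.
by rewrite !scalerDr addrACA.
Qed.

HB.instance Definition _ := PreTopologicalLmod_isTvs.Build R (dsum G E)
  dsum_add_continuous dsum_scale_continuous dsum_locally_convex.

Lemma dsum_in_continuous (g : G) : continuous (fun e : E => dsum_in g e).
Proof.
move=> e A [V [_ [_ nV]] VA].
have /= := @add_continuous E (e, - e); rewrite /continuous_at /= subrr.
move=> /(_ _ (nV g)) [[B C] /= [nB nC] BC].
apply: filterS nB => x Bx /=.
have -> : dsum_in g x = dsum_in g e + dsum_in g (x - e).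
  by rewrite -dsum_inD addrC subrK.
by apply: VA; apply: (BC (x, - e)); split=> //; exact: nbhs_singleton nC.
Qed.

Lemma dsum_linear_continuous (F : tvsType R) (f : {linear dsum G E -> F}) :
  (forall g, continuous (fun e : E => f (dsum_in g e))) -> continuous f.
Proof.
move=> cf u A nA.
have [B cB [oB nbB]] := @locally_convex R F.
have nA0 : nbhs (0 : F) [set y | A (f u + y)].
  have /= := @add_continuous F (f u, 0); rewrite /continuous_at /= addr0.
  move=> /(_ _ nA) [[C D] /= [nC nD] CD]; apply: filterS nD => y Dy /=.
  by apply: (CD (f u, y)); split=> //; exact: nbhs_singleton nC.
have [b [Bb b0] bA] := nbB _ _ nA0.
exists (f @^-1` b); last by move=> v /bA /=; rewrite raddfD.
split; last split; rewrite /= ?raddf0//.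
  have /convex_setP cb := cB _ (mem_set Bb).
  by apply/convex_setP => x y t t0 t1 /= bx bz; rewrite linearD !linearZZ; exact: cb.
move=> g; have := cf g 0; rewrite /continuous_at /= dsum_in0 raddf0.
by apply; apply: open_nbhs_nbhs; split=> //; exact: oB.
Qed.

End DsumTopology.

Section Convolution.
Context (R : realType) (E1 E2 F : lmodType R) (b : {bilinear E1 -> E2 -> F}).
Context (G : groupType).

(* The convolution for the Haar measure lam * (counting measure) on G; the
   product of the supports contains the support of the convolution. *)
Definition bconv (lam : R) (u : dsum G E1) (v : dsum G E2) : dsum G F :=
  [fsfun x in [fset (y * z)%g | y in finsupp u, z in finsupp v]%fset =>
     lam *: \sum_(y <- finsupp u) b (u y) (v (y^-1 * x)%g)].

Lemma bconvE lam u v x :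
  bconv lam u v x = lam *: \sum_(y <- finsupp u) b (u y) (v (y^-1 * x)%g).
Proof.
rewrite fsfunE; case: ifPn => // xuv; rewrite big1_seq ?scaler0// => y /andP[_ yu].
have [yxv|yxv] := finsuppP v (y^-1 * x)%g; first by rewrite linear0r.
case/negP: xuv; apply/imfset2P; exists y => //; exists (y^-1 * x)%g => //.
by rewrite mulgA mulgV mul1g.
Qed.

End Convolution.

Section Seminorms.
Context (R : realType).

Definition seminorm (E : lmodType R) (p : E -> R) :=
  [/\ forall x, 0 <= p x,
      forall x y, p (x + y) <= p x + p y &
      forall a x, p (a *: x) = `|a| * p x].

Definition continuous_seminorm (E : tvsType R) (p : E -> R) :=
  seminorm p /\ continuous p.

Definition product_estimates (E1 E2 F : tvsType R)
    (b : {bilinear E1 -> E2 -> F}) :=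
  forall p : nat -> nat -> F -> R, (forall i j, continuous_seminorm (p i j)) ->
  exists (p1 : nat -> E1 -> R) (p2 : nat -> E2 -> R),
    [/\ forall i, continuous_seminorm (p1 i),
        forall j, continuous_seminorm (p2 j) &
        forall i j x y, p i j (b x y) <= p1 i x * p2 j y].

End Seminorms.

(* Main.v *)
Require Import Defs.
From HB Require Import structures.
From mathcomp Require Import all_boot all_order all_algebra finmap.
From mathcomp Require Import all_classical all_reals all_analysis.
From mathcomp Require Import lra.
Import Order.TTheory GRing.Theory Num.Theory.
Import numFieldNormedType.Exports.

Local Open Scope classical_set_scope.
Local Open Scope ring_scope.

(** A neighbourhood of 0 in a direct sum may be chosen independently on each
    summand, and [bconv b lam (dsum_in g x) (dsum_in h y)] lives on the summand
    [g * h] only, where it equals [lam *: b x y].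

    If [G] is countable and [b] admits product estimates, let [V] be a convex
    neighbourhood of 0 in the sum of the [F]s. Each trace of [V] on a summand
    contains the unit ball of a continuous seminorm, so that [V] is described by
    seminorms indexed by the products of two places; the product estimates
    majorize them by products of a seminorm depending on the first place and one
    depending on the second. Multiplying the latter by powers of 2 gives boxes in
    the two factors for which the convolution is a convex combination of elements
    of [V] ([product_estimates_bconv_continuous]).

    Conversely, the proof needs many places [g_s] and [h_t] whose products are
    pairwise distinct, since then the neighbourhood of 0 in the target can be
    prescribed separately for each pair of places. A maximal family of this kind,
    obtained from Zorn's lemma, is infinite when [G] is, and uncountable when [G]
    is ([exists_large_grid]). Given a double sequence of seminorms on [F], place
    the unit ball of the seminorm of index [(i, j)] at [g_i * h_j]; the
    neighbourhoods provided by continuity contain unit balls of seminorms at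
    [g_i] and at [h_j], and bilinearity turns the resulting inclusion into the
    product estimate ([bconv_continuous_product_estimates]).

    For the countability of [G], the pairs of the family also carry distinct
    labels in the Cantor set. Fix a continuous seminorm [p] which does not vanish
    at [b x0 y0], and prescribe [m * p < 1] at [g_s * h_t] when the labels of [s]
    and [t] have a common prefix of length [m]. If the family were uncountable,
    infinitely many of its members would share one scale [1 / n.+1] bringing both
    [x0] and [y0] into the given neighbourhoods. Among infinitely many labels some
    two have an arbitrarily long common prefix, which contradicts the bound that
    the fixed scale imposes on [m] ([bconv_continuous_countable]). *)

(** * Seminorms and neighbourhoods of the origin *)

Section Seminorm.
Context {R : realType} {E : lmodType R} (p : E -> R) (sp : seminorm p).

Lemma seminorm_ge0 x : 0 <= p x.
Proof. by case: sp. Qed.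

Lemma seminormD x y : p (x + y) <= p x + p y.
Proof. by case: sp. Qed.

Lemma seminormZ a x : p (a *: x) = `|a| * p x.
Proof. by case: sp. Qed.

Lemma seminorm0 : p 0 = 0.
Proof. by rewrite -(scale0r (0 : E)) seminormZ normr0 mul0r. Qed.

Lemma seminorm_convex t x y r : 0 <= t -> t <= 1 -> p x < r -> p y < r ->
  p (t *: x + (1 - t) *: y) < r.
Proof.
move=> t0 t1 px py; apply: le_lt_trans (seminormD _ _) _.
rewrite !seminormZ !ger0_norm ?subr_ge0//.
have [->|tn0] := eqVneq t 0; first by rewrite mul0r add0r subr0 mul1r.
have -> : r = t * r + (1 - t) * r by rewrite -mulrDl addrC subrK mul1r.
apply: ltr_leD; first by rewrite ltr_pM2l// lt_neqAle eq_sym tn0.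
by rewrite ler_wpM2l ?subr_ge0// ltW.
Qed.

Lemma seminorm_scale c : 0 <= c -> seminorm (fun x => c * p x).
Proof.
move=> c0; split=> [x|x y|a x]; first by rewrite mulr_ge0// seminorm_ge0.
- by rewrite -mulrDr ler_wpM2l// seminormD.
- by rewrite seminormZ mulrCA.
Qed.

End Seminorm.

Section ContinuousSeminorm.
Context {R : realType} {E : tvsType R}.

Lemma continuous_seminorm_scale (p : E -> R) c : 0 <= c ->
  continuous_seminorm p -> continuous_seminorm (fun x => c * p x).
Proof.
move=> c0 [sp cp]; split; first exact: seminorm_scale.
by move=> x; apply: cvgM; [exact: cvg_cst|exact: cp].
Qed.

Lemma nbhs0_seminorm_lt {p : E -> R} r : continuous_seminorm p -> 0 < r ->
  nbhs (0 : E) [set x | p x < r].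
Proof.
move=> [sp cp] r0; have := cp 0; rewrite /continuous_at seminorm0// => /cvgr_lt.
by apply.
Qed.

Lemma nbhs0_absorb (U : set E) x : nbhs (0 : E) U ->
  \forall t \near (0 : R^o), U (t *: x).
Proof.
move=> nU; have := @scale_continuous R E (0, x).
rewrite /continuous_at /= scale0r => /(_ _ nU) [[A B] /= [nA nB] AB].
apply: filterS nA => t At; apply: (AB (t, x)); split=> //.
exact: nbhs_singleton nB.
Qed.

Lemma nbhs0_scale (U : set E) (a : R) : nbhs (0 : E) U ->
  nbhs (0 : E) [set x | U (a *: x)].
Proof.
move=> nU; have := @scale_continuous R E (a, 0).
rewrite /continuous_at /= scaler0 => /(_ _ nU) [[A B] /= [nA nB] AB].
apply: filterS nB => x Bx; apply: (AB (a, x)); split=> //.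
exact: nbhs_singleton nA.
Qed.

End ContinuousSeminorm.

Lemma near0_gt0 {R : realType} (A : set R^o) : nbhs (0 : R^o) A ->
  exists2 t : R, 0 < t & A t.
Proof.
move=> /nbhs_ballP[e /= e0 eA]; exists (e / 2); first by rewrite divr_gt0.
apply: eA; rewrite /ball /= sub0r normrN gtr0_norm ?divr_gt0//.
by rewrite ltr_pdivrMr// ltr_pMr// ltr1n.
Qed.

Section Gauge.
Context {R : realType} {E : tvsType R} (C : set E).
Hypothesis convexC : forall x y t, 0 <= t -> t <= 1 -> C x -> C y ->
  C (t *: x + (1 - t) *: y).
Hypothesis nbhsC : nbhs (0 : E) C.
Hypothesis symC : forall x, C x -> C (- x).

Definition gauge (x : E) : R := inf [set t | 0 < t /\ C (t^-1 *: x)].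

Lemma gauge_has_inf x : has_inf [set t | 0 < t /\ C (t^-1 *: x)].
Proof.
split; last by exists 0 => t [/ltW].
have [t t0 Ct] := near0_gt0 _ (nbhs0_absorb C x nbhsC).
by exists t^-1; split; rewrite ?invr_gt0 ?invrK.
Qed.

Lemma gauge_ge0 x : 0 <= gauge x.
Proof.
by have [n0 _] := gauge_has_inf x; apply: lb_le_inf => // t [/ltW].
Qed.

Lemma gauge_le t x : 0 < t -> C (t^-1 *: x) -> gauge x <= t.
Proof. by move=> t0 Ct; apply: ge_inf => //; case: (gauge_has_inf x). Qed.

(** Convexity and [C 0] make [t *: C] increase with [t], so that the infimum
    defining [gauge x] is exceeded only by admissible [t]. *)
Lemma gauge_lt t x : gauge x < t -> C (t^-1 *: x).
Proof.
have [n0 _] := gauge_has_inf x => /(inf_lt n0)[s [s0 Cs] st].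
have t0 := lt_trans s0 st.
have -> : t^-1 *: x = (s / t) *: (s^-1 *: x) + (1 - s / t) *: 0.
  by rewrite scaler0 addr0 scalerA mulrAC divff ?lt0r_neq0// mul1r.
apply: convexC => //; first by rewrite divr_ge0// ltW.
- by rewrite ler_pdivrMr// mul1r ltW.
- exact: nbhs_singleton.
Qed.

Lemma gaugeD x y : gauge (x + y) <= gauge x + gauge y.
Proof.
apply/ler_addgt0Pr => e e0.
have e20 : 0 < e / 2 by rewrite divr_gt0.
set s := gauge x + e / 2; set t := gauge y + e / 2.
have s0 : 0 < s by rewrite ltr_wpDl// gauge_ge0.
have t0 : 0 < t by rewrite ltr_wpDl// gauge_ge0.
have st0 : 0 < s + t by rewrite addr_gt0.
have -> : gauge x + gauge y + e = s + t by rewrite addrACA -splitr.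
apply: gauge_le => //.
have Cx : C (s^-1 *: x) by apply: gauge_lt; rewrite ltrDl.
have Cy : C (t^-1 *: y) by apply: gauge_lt; rewrite ltrDl.
have := convexC _ _ (s / (s + t)) _ _ Cx Cy.
have -> : 1 - s / (s + t) = t / (s + t).
  by rewrite -[X in X - _](divff (lt0r_neq0 st0)) -mulrBl addrC addKr.
rewrite !scalerA ![_ / (s + t)]mulrC -!mulrA !divff ?lt0r_neq0// !mulr1 scalerDr.
apply; first by rewrite mulr_ge0// ?invr_ge0 ltW.
by rewrite ler_pdivrMl// mulr1 lerDl ltW.
Qed.

Lemma gauge_leZ a x : 0 < a -> gauge (a *: x) <= a * gauge x.
Proof.
move=> a0; rewrite -ler_pdivrMl//; apply/ler_addgt0Pr => e e0.
have t0 : 0 < gauge x + e by rewrite ltr_wpDl// gauge_ge0.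
rewrite ler_pdivrMl//; apply: gauge_le; first by rewrite mulr_gt0.
rewrite scalerA invfM mulrAC mulVf ?lt0r_neq0// mul1r.
by apply: gauge_lt; rewrite ltrDl.
Qed.

Lemma gaugeN x : gauge (- x) = gauge x.
Proof.
have le y : gauge (- y) <= gauge y.
  apply/ler_addgt0Pr => e e0.
  apply: gauge_le; first by rewrite ltr_wpDl// gauge_ge0.
  by rewrite scalerN; apply/symC/gauge_lt; rewrite ltrDl.
by apply/eqP; rewrite eq_le le -[X in gauge X <= _]opprK le.
Qed.

Lemma gauge0 : gauge 0 = 0.
Proof.
apply/eqP; rewrite eq_le gauge_ge0 andbT; apply/ler_addgt0Pr => e e0; rewrite add0r.
by apply: gauge_le; rewrite // scaler0; exact: nbhs_singleton.
Qed.

Lemma gaugeZ_gt0 a x : 0 < a -> gauge (a *: x) = a * gauge x.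
Proof.
move=> a0; apply/eqP; rewrite eq_le gauge_leZ//=.
rewrite -ler_pdivlMl// -[X in gauge X <= _](scalerK (lt0r_neq0 a0)).
by rewrite gauge_leZ// invr_gt0.
Qed.

Lemma gauge_seminorm : seminorm gauge.
Proof.
split=> [|//|a x]; [exact: gauge_ge0|exact: gaugeD|].
have [a0|a0|->] := ltgtP a 0; last by rewrite scale0r gauge0 normr0 mul0r.
- by rewrite ltr0_norm// -gaugeZ_gt0 ?oppr_gt0// scaleNr gaugeN.
- by rewrite gtr0_norm// gaugeZ_gt0.
Qed.

Lemma gauge_continuous : continuous gauge.
Proof.
move=> x; apply/cvgrPdist_le => /= e e0.
have : nbhs (x - x) [set y | C (e^-1 *: y)].
  by rewrite subrr; exact: nbhs0_scale.
move=> /(@sub_continuous E (x, x)) [[A B] /= [nA nB] AB].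
apply: filterS nB => y By.
have le : gauge (x - y) <= e.
  by apply: gauge_le => //; apply: (AB (x, y)); split=> //; exact: nbhs_singleton nA.
rewrite ler_norml; apply/andP; split.
- rewrite lerNl opprB lerBlDr (le_trans _ (_ : gauge (y - x) + gauge x <= _))//.
    by rewrite -{1}(subrK x y) gaugeD.
  by rewrite lerD2r -gaugeN opprB.
- rewrite lerBlDr (le_trans _ (_ : gauge (x - y) + gauge y <= _))//.
    by rewrite -{1}(subrK y x) gaugeD.
  by rewrite lerD2r.
Qed.

End Gauge.

(** Continuous seminorms describe the topology: the one produced here is the
    Minkowski functional of the symmetrization of a convex neighbourhood of 0
    inside [U]. *)
Lemma seminorm_in_nbhs0 (R : realType) (E : tvsType R) (U : set E) :
  nbhs (0 : E) U ->
  exists2 p, continuous_seminorm p & forall x, p x < 1 -> U x.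
Proof.
move=> nU; have [B cB [oB nbB]] := @locally_convex R E.
have [c [Bc c0] cU] := nbB _ _ nU.
have /convex_setP cc := cB _ (mem_set Bc).
have nc : nbhs (0 : E) c by apply: open_nbhs_nbhs; split=> //; exact: oB.
pose C := c `&` [set x | c (- x)].
have nC : nbhs (0 : E) C.
  apply: filterI => //; have := nbhs0_scale c (-1) nc.
  by apply: filterS => x /=; rewrite scaleN1r.
have cC x y t : 0 <= t -> t <= 1 -> C x -> C y -> C (t *: x + (1 - t) *: y).
  move=> t0 t1 [cx cNx] [cy cNy]; split; first exact: cc.
  by rewrite /= opprD -!scalerN; exact: cc.
have sC x : C x -> C (- x) by move=> [cx cNx]; split; rewrite /= ?opprK.
exists (gauge C).
  by split; [exact: gauge_seminorm|exact: gauge_continuous].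
move=> x /(gauge_lt C cC nC); rewrite invr1 scale1r => -[cx _]; exact: cU.
Qed.

(** In a Hausdorff space the continuous seminorms separate points. *)
Lemma seminorm_separates (R : realType) (E : tvsType R) (x : E) :
  hausdorff_space E -> x <> 0 ->
  exists2 p : E -> R, continuous_seminorm p & 0 < p x.
Proof.
move=> hE x0.
have [U nU Ux] : exists2 U, nbhs (0 : E) U & ~ U x.
  apply: contrapT => /forall2NP h; apply: x0; apply: hE => A B nA nB.
  have nA' : nbhs (0 : E) [set y | A (x - y)].
    have := @sub_continuous E (x, 0); rewrite /continuous_at /= subr0.
    move=> /(_ _ nA) [[P Q] /= [nP nQ] PQ]; apply: filterS nQ => y Qy.
    by apply: (PQ (x, y)); split=> //; exact: nbhs_singleton nP.
  exists 0; split; last exact: nbhs_singleton.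
  have [//|/contrapT] := h [set y | A (x - y)].
  by rewrite /= subrr.
have [p cp pU] := seminorm_in_nbhs0 _ _ _ nU.
exists p => //; rewrite lt_def (seminorm_ge0 _ cp.1) andbT.
apply/eqP => px; apply: Ux; apply: pU; by rewrite px.
Qed.

(** * Neighbourhoods of the origin in direct sums, and convolution *)

(** Seminorm boxes: the seminorm of each summand is chosen independently of the
    others, however many summands there are. *)
Lemma dsum_nbhs0_box (R : realType) (G : choiceType) (E : tvsType R)
    (q : G -> E -> R) : (forall g, continuous_seminorm (q g)) ->
  dsum_nbhs0 [set u : dsum G E | forall g, q g (u g) < 1].
Proof.
move=> cq; split; [|split=> [g|g]].
- apply/convex_setP => u v t t0 t1 /= qu qv g; rewrite dsumDE !dsumZE.
  by apply: seminorm_convex => //; case: (cq g).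
- by rewrite dsum0E seminorm0//; case: (cq g).
- apply: filterS (nbhs0_seminorm_lt 1 (cq g) ltr01) => e /= qe h.
  by rewrite dsum_inE; case: eqP => [->//|_]; rewrite seminorm0//; case: (cq h).
Qed.

(** The strict inequality keeps [1 - w i] positive, so that the induction may
    divide the remaining weights by it. *)
Lemma sum_convex_lt1 (R : realType) (M : lmodType R) (V : set M) (I : Type)
    (s : seq I) (w : I -> R) (x : I -> M) :
  @convex_set R M V -> V 0 -> (forall i, 0 <= w i) ->
  \sum_(i <- s) w i < 1 -> (forall i, V (x i)) -> V (\sum_(i <- s) w i *: x i).
Proof.
move=> /convex_setP cV V0 + + Vx.
elim: s w => [|i s IH] w w0; first by rewrite !big_nil.
rewrite !big_cons => sw1.
have s0 : 0 <= \sum_(j <- s) w j by apply: sumr_ge0.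
have wi1 : w i < 1 by apply: le_lt_trans sw1; rewrite lerDl.
have c0 : 0 < 1 - w i by rewrite subr_gt0.
have -> : \sum_(j <- s) w j *: x j =
    (1 - w i) *: \sum_(j <- s) (w j / (1 - w i)) *: x j.
  rewrite scaler_sumr; apply: eq_bigr => j _.
  by rewrite scalerA mulrC divfK// lt0r_neq0.
apply: cV => //; first exact: ltW.
apply: (IH (fun j => w j / (1 - w i))) => [j|].
  by rewrite divr_ge0// ltW.
by rewrite -mulr_suml ltr_pdivrMr// mul1r ltrBrDl.
Qed.

Lemma sum_geometric_lt1 (R : realType) (I : eqType) (s : seq I) (f : I -> nat) :
  injective f -> uniq s -> \sum_(i <- s) (2 ^- (f i).+1 : R) < 1.
Proof.
move=> injf us; pose N := (\max_(i <- s) f i).+1.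
have -> : \sum_(i <- s) (2 ^- (f i).+1 : R) =
    \sum_(k <- map f s) 2 ^- k.+1 by rewrite big_map.
have le : \sum_(k <- map f s) (2 ^- k.+1 : R) <= \sum_(0 <= k < N) 2 ^- k.+1.
  rewrite [leRHS](bigID (mem (map f s)))/= -[leLHS]addr0; apply: lerD.
    rewrite -[leRHS]big_filter le_eqVlt; apply/orP; left; apply/eqP.
    apply: perm_big; apply: uniq_perm;
      rewrite ?map_inj_uniq ?filter_uniq ?iota_uniq// => k.
    rewrite mem_filter mem_index_iota /= andb_idr// => /mapP[i si ->].
    by rewrite ltnS; apply: leq_bigmax_seq.
  by apply: sumr_ge0 => k _; rewrite invr_ge0 exprn_ge0.
apply: le_lt_trans le _.
have -> : \sum_(0 <= k < N) (2 ^- k.+1 : R) = 1 - 2 ^- N.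
  elim: N => [|N IH]; first by rewrite big_geq// expr0 invr1 subrr.
  rewrite big_nat_recr//= IH exprS invfM.
  by rewrite [in LHS](splitr (2 ^- N)) mulrC; lra.
by rewrite ltrBlDr ltrDl invr_gt0 exprn_gt0.
Qed.

Section BconvAlgebra.
Context {R : realType} {E1 E2 F : lmodType R} (b : {bilinear E1 -> E2 -> F}).
Context {G : groupType} (lam : R).
Implicit Types (u : dsum G E1) (v : dsum G E2).

(** Summing over any superset of the support of [u] makes the sums for different
    functions comparable. *)
Lemma bconv_supE (A : {fset G}) u v x : {subset finsupp u <= A} ->
  bconv b lam u v x = lam *: \sum_(y <- A) b (u y) (v (y^-1 * x)%g).
Proof.
move=> uA; rewrite bconvE; congr (_ *: _).
rewrite [RHS](bigID (mem (finsupp u)))/= [X in _ = _ + X]big1 ?addr0; last first.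
  by move=> y yu; rewrite fsfun_dflt// linear0l.
rewrite -[RHS]big_filter; apply: perm_big; apply: uniq_perm.
- exact: fset_uniq.
- by rewrite filter_uniq// fset_uniq.
- by move=> y; rewrite mem_filter /= andb_idr// => /uA.
Qed.

Lemma bconvDl u u' v : bconv b lam (u + u') v = bconv b lam u v + bconv b lam u' v.
Proof.
apply/fsfunP => x; rewrite dsumDE.
pose A := (finsupp u `|` finsupp u' `|` finsupp (u + u')%R)%fset.
rewrite !(@bconv_supE A) -?scalerDr -?big_split /=.
- by congr (_ *: _); apply: eq_bigr => y _; rewrite dsumDE linearDl.
- by move=> y yu; rewrite !in_fsetU yu orbT.
- by move=> y yu; rewrite !in_fsetU yu.
- by move=> y yu; rewrite !in_fsetU yu !orbT.
Qed.

Lemma bconvDr u v v' : bconv b lam u (v + v') = bconv b lam u v + bconv b lam u v'.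
Proof.
apply/fsfunP => x; rewrite dsumDE !bconvE -scalerDr -big_split /=.
by congr (_ *: _); apply: eq_bigr => y _; rewrite dsumDE linearDr.
Qed.

Lemma bconv_rescale u v t : t != 0 ->
  bconv b lam (t *: u) (t^-1 *: v) = bconv b lam u v.
Proof.
move=> t0; apply/fsfunP => x; rewrite (@bconv_supE (finsupp u)) ?bconvE.
  congr (_ *: _); apply: eq_bigr => y _.
  by rewrite !dsumZE linearZl linearZr/= scalerA divff// scale1r.
move=> y; rewrite !mem_finsupp dsumZE; apply: contraNneq => ->.
by rewrite scaler0.
Qed.

Lemma bconv_in (g h : G) e e' :
  bconv b lam (dsum_in g e) (dsum_in h e') = dsum_in (g * h)%g (lam *: b e e').
Proof.
apply/fsfunP => x; rewrite (@bconv_supE [fset g]%fset); last first.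
  move=> y; rewrite mem_finsupp dsum_inE in_fset1.
  by case: (y == g); rewrite ?eqxx.
rewrite big_seq_fset1 !dsum_inE eqxx.
have -> : ((g^-1 * x)%g == h) = (x == (g * h)%g).
  apply/eqP/eqP => [<-|->]; first by rewrite mulgA mulgV mul1g.
  by rewrite mulgA mulVg mul1g.
by case: ifP; rewrite ?linear0r ?scaler0.
Qed.

Lemma bconv_decomp u v : bconv b lam u v =
  \sum_(y <- finsupp u) \sum_(z <- finsupp v)
     dsum_in (y * z)%g (lam *: b (u y) (v z)).
Proof.
have E (v' : dsum G E2) :
    {morph (fun u : dsum G E1 => bconv b lam u v') : x y / x + y >-> x + y}.
  by move=> x y; exact: bconvDl.
have bconv0l (v' : dsum G E2) : bconv b lam (0 : dsum G E1) v' = 0.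
  by apply: (addrI (bconv b lam (0 : dsum G E1) v')); rewrite -bconvDl !addr0.
have bconv0r (u' : dsum G E1) : bconv b lam u' (0 : dsum G E2) = 0.
  by apply: (addrI (bconv b lam u' (0 : dsum G E2))); rewrite -bconvDr !addr0.
rewrite [in LHS](dsum_decomp u) (big_morph _ (E v) (bconv0l v)).
apply: eq_bigr => y _.
rewrite [in LHS](dsum_decomp v) (big_morph _ (bconvDr _) (bconv0r _)).
by apply: eq_bigr => z _; rewrite bconv_in.
Qed.

End BconvAlgebra.

Section BconvContinuity.
Context {R : realType} {E1 E2 F : tvsType R} (b : {bilinear E1 -> E2 -> F}).
Context {G : groupType} (lam : R).

Lemma bconv_continuous_nbhs0 (V : set (dsum G F)) : dsum_nbhs0 V ->
  continuous (fun p : dsum G E1 * dsum G E2 => bconv b lam p.1 p.2) ->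
  exists W1 W2, [/\ dsum_nbhs0 W1, dsum_nbhs0 W2 &
    forall u v, W1 u -> W2 v -> V (bconv b lam u v)].
Proof.
move=> nV /(_ (0, 0)); rewrite /continuous_at /=.
have -> : bconv b lam (0 : dsum G E1) (0 : dsum G E2) = 0.
  apply: (addrI (bconv b lam (0 : dsum G E1) (0 : dsum G E2))).
  by rewrite -bconvDl !addr0.
have nV' : nbhs (0 : dsum G F) V by exists V => // v Vv; rewrite add0r.
move=> /(_ _ nV') [[A B] /= [[W1 nW1 W1A] [W2 nW2 W2B]] AB].
exists W1, W2; split=> // u v /W1A W1u /W2B W2v.
by apply: (AB (u, v)); rewrite -[u]add0r -[v]add0r.
Qed.

(** A bilinear map of topological vector spaces is continuous as soon as it is
    continuous at the origin; the mixed terms are moved near the origin by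
    [bconv_rescale], since [u] and [v] are absorbed by any neighbourhood. *)
Lemma nbhs0_bconv_continuous :
  (forall V : set (dsum G F), dsum_nbhs0 V ->
    exists W1 W2, [/\ dsum_nbhs0 W1, dsum_nbhs0 W2 &
      forall u v, W1 u -> W2 v -> V (bconv b lam u v)]) ->
  continuous (fun p : dsum G E1 * dsum G E2 => bconv b lam p.1 p.2).
Proof.
move=> cb0 [u v] A /= [V nV VA].
pose V2 := [set w : dsum G F | V (2 *: w)].
have nV2 : dsum_nbhs0 V2 := dsum_nbhs0M2 nV.
pose V4 := [set w : dsum G F | V2 (2 *: w)].
have nV4 : dsum_nbhs0 V4 := dsum_nbhs0M2 nV2.
have [W1 [W2 [nW1 nW2 WV4]]] := cb0 _ nV4.
have [t t0 [W1u W2v]] : exists2 t : R, 0 < t & W1 (t *: u) /\ W2 (t *: v).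
  by apply: near0_gt0; apply: filterI; exact: dsum_absorb.
have tV0 : t^-1 != 0 by rewrite invr_eq0 lt0r_neq0.
pose N1 := W1 `&` [set u' | W1 (t^-1 *: u')].
pose N2 := W2 `&` [set v' | W2 (t^-1 *: v')].
exists (+%R u @` N1, +%R v @` N2) => /=.
  split.
    exists N1; last by move=> w N1w; exists w.
    by apply: dsum_nbhs0I => //; exact: dsum_nbhs0Z.
  exists N2; last by move=> w N2w; exists w.
  by apply: dsum_nbhs0I => //; exact: dsum_nbhs0Z.
move=> [_ _] /= [[u' [W1u' /= W1tu'] <-] [v' [W2v' /= W2tv'] <-]].
rewrite bconvDl !bconvDr -addrA; apply: VA.
have V40 w : V4 w -> V2 w.
  move=> V4w; rewrite -[w]addr0; apply: dsum_half => //.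
  by rewrite scaler0; case: nV2 => _ [].
apply: dsum_half => //.
  apply: V40; rewrite -(bconv_rescale b lam u v' t) ?lt0r_neq0//.
  exact: WV4.
apply: (@dsum_half _ _ _ V2) => //; last exact: WV4.
rewrite -(bconv_rescale b lam u' v t^-1)// invrK; exact: WV4.
Qed.

End BconvContinuity.

(** * Grids of distinct products in a group *)

Lemma countableU {T : Type} (A B : set T) :
  countable A -> countable B -> countable (A `|` B).
Proof. by move=> cA cB; rewrite -bigcup2E; apply: bigcup_countable => // -[|[|i]] _. Qed.

Section Grid.
Context {G : groupType}.
Local Notation T := (G * G * (nat -> bool))%type.

(** The products [g * h], with [g] and [h] first and second coordinates of two
    elements of [S], determine these elements; so, in convolutions of functions
    coordinatesed on the two projections of [S], no two terms fall on the same
    summand. The third coordinate labels the elements by binary sequences. *)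
Definition grid (S : set T) :=
  (forall p q p' q', S p -> S q -> S p' -> S q' ->
     (p.1.1 * q.1.2 = p'.1.1 * q'.1.2)%g -> p = p' /\ q = q') /\
  (forall p q, S p -> S q -> p.2 = q.2 -> p = q).

(** If [x] avoids this set, no equation [x * m = k * l] holds with [k], [l], [m]
    in [A]; in particular [x] is not in [A]. *)
Definition forbidden_left (A : set G) : set G :=
  [set (p.1.1 * p.1.2 * p.2^-1)%g | p in A `*` A `*` A].

(** If [y] avoids this set, no equation [k * y = k' * l] holds with [k], [k'], [l]
    in [A]; in particular [y] is not in [A]. *)
Definition forbidden_right (A : set G) : set G :=
  [set (p.1.1^-1 * p.1.2 * p.2)%g | p in A `*` A `*` A].

Definition coordinates (S : set T) : set G :=
  [set p.1.1 | p in S] `|` [set p.1.2 | p in S].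

Lemma countable_diagonal (Z : set (nat -> bool)) : countable Z ->
  exists z, ~ Z z.
Proof.
move=> /countable_injP[f injf].
exists (fun n => ~~ `[< exists2 s, Z s & f s = n /\ s n >]); set z := (X in Z X).
move=> Zz; have zE : z (f z) = ~~ z (f z).
  rewrite {1}/z; congr negb; apply/asboolP/idP => [[s Zs [fs sz]]|zz].
    by rewrite (injf _ _ (mem_set Zs) (mem_set Zz) fs) in sz.
  by exists z.
by case: (z (f z)) zE.
Qed.

(** The first coordinate [x] is chosen before the second coordinate [y], and
    words for [y] may use [x]: this is how the products [x * h], [g * y] and
    [x * y] stay apart from each other and from the old ones. *)
Lemma grid_extend (S : set T) x y z : grid S ->
  ~ forbidden_left (coordinates S) x -> ~ forbidden_right (x |` coordinates S) y ->
  ~ [set p.2 | p in S] z -> grid ((x, y, z) |` S).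
Proof.
move=> [gS iS] Xx Yy Zz.
have gA p : S p -> coordinates S p.1.1 by move=> Sp; left; exists p.
have hA p : S p -> coordinates S p.1.2 by move=> Sp; right; exists p.
have nx k l m : coordinates S k -> coordinates S l -> coordinates S m ->
    (x * m)%g <> (k * l)%g.
  move=> Ak Al Am e; apply: Xx; exists (k, l, m); first by split.
  by rewrite /= -e -mulgA mulgV mulg1.
have ny k k' l : (x |` coordinates S) k -> (x |` coordinates S) k' ->
    coordinates S l -> (k * y)%g <> (k' * l)%g.
  move=> Ak Ak' Al e; apply: Yy; exists (k, k', l); first by split=> //; right.
  by rewrite /= -mulgA -e mulgA mulVg mul1g.
split; last first.
  move=> p q [->|Sp] [->|Sq] //= e.
    by case: Zz; exists q.
    by case: Zz; exists p.
  exact: iS.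
have K p : ((x, y, z) |` S) p -> (x |` coordinates S) p.1.1.
  by move=> [->|/gA Ap]; [left|right].
move=> p q p' q' Np Nq Np' Nq' e.
have gL := K _ Np; have gL' := K _ Np'.
case: Nq Nq' e => [->|Sq] [->|Sq'] /= e.
- split=> //; have {}e := mulIg _ _ _ e.
  case: Np Np' e {gL gL'} => [->|Sp] [->|Sp'] //= e.
  + by case: (nx _ _ _ (gA _ Sp') (hA _ Sp') (hA _ Sp')
      (congr1 (fun t => t * p'.1.2)%g e)).
  + by case: (nx _ _ _ (gA _ Sp) (hA _ Sp) (hA _ Sp)
      (congr1 (fun t => t * p.1.2)%g (esym e))).
  + by have [] := gS p p p' p Sp Sp Sp' Sp; rewrite ?e.
- by case: (ny _ _ _ gL gL' (hA _ Sq')).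
- by case: (ny _ _ _ gL' gL (hA _ Sq)).
- case: Np Np' e {gL gL'} => [->|Sp] [->|Sp'] /= e.
  + split=> //; have {}e := mulgI _ _ _ e.
    by have [] := gS q q q q' Sq Sq Sq Sq'; rewrite ?e.
  + by case: (nx _ _ _ (gA _ Sp') (hA _ Sq') (hA _ Sq)).
  + by case: (nx _ _ _ (gA _ Sp) (hA _ Sq) (hA _ Sq')).
  + exact: gS.
Qed.

Lemma grid_bigcup (C : set (set T)) : C `<=` grid -> total_on C subset ->
  grid (\bigcup_(S in C) S).
Proof.
move=> gC tC.
have two S S' : C S -> C S' -> exists2 S'', C S'' & S `|` S' `<=` S''.
  move=> CS CS'; have [le|le] := tC _ _ CS CS'.
    by exists S' => // p [/le|].
  by exists S => // p [|/le].
split=> [p q p' q' [S CS Sp] [S1 CS1 S1q] [S2 CS2 S2p] [S3 CS3 S3q]|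
         p q [S CS Sp] [S1 CS1 S1q]].
  have [U CU sU] := two _ _ CS CS1; have [U' CU' sU'] := two _ _ CS2 CS3.
  have [W CW sW] := two _ _ CU CU'; have [gW _] := gC _ CW.
  apply: gW; apply: sW.
  - by left; apply: sU; left.
  - by left; apply: sU; right.
  - by right; apply: sU'; left.
  - by right; apply: sU'; right.
have [U CU sU] := two _ _ CS CS1; have [_ iU] := gC _ CU.
by apply: iU; apply: sU; [left|right].
Qed.

(** A maximal grid is as large as the group, up to finiteness and up to
    countability: a maximal countable grid leaves no room in [G] outside the
    words of length three on its coordinates and on one more element. *)
Lemma exists_large_grid : exists S : set T, [/\ grid S,
  finite_set S -> finite_set [set: G] & countable S -> countable [set: G]].
Proof.
have [S [gS maxS]] := Zorn_bigcup grid_bigcup.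
have cover : countable S -> exists x, [set: G] `<=`
    forbidden_left (coordinates S) `|` forbidden_right (x |` coordinates S).
  move=> cS; apply: contrapT => /forallNP h.
  have [x Xx] : exists x, ~ forbidden_left (coordinates S) x.
    by apply/existsNP => X; apply: (h 1%g) => y _; left.
  have [y Yy] : exists y, ~ forbidden_right (x |` coordinates S) y.
    by apply/existsNP => Y; apply: (h x) => y _; right.
  have [z Zz] : exists z, ~ [set p.2 | p in S] z.
    by apply: countable_diagonal; apply: sub_countable (card_image_le _ _) cS.
  apply: (maxS ((x, y, z) |` S)); last exact: grid_extend.
  split=> [p Sp|/(_ (x, y, z)) /(_ (or_introl erefl)) Sxyz]; first by right.
  by apply: Zz; exists (x, y, z).
exists S; split=> // hS.
  have [x /sub_finite_set] := cover (finite_set_countable hS); apply.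
  have fA : finite_set (coordinates S).
    by rewrite finite_setU; split; exact: finite_image.
  have fA' : finite_set (x |` coordinates S).
    by rewrite finite_setU; split => //; exact: finite_set1.
  by rewrite finite_setU; split; apply: finite_image; apply: finite_setX => //;
    exact: finite_setX.
have [x /subset_card_le le] := cover hS; apply: sub_countable le _.
have cI (U : Type) (f : U -> G) (A : set U) : countable A -> countable (f @` A).
  by move=> cA; apply: sub_countable (card_image_le _ _) cA.
have cA : countable (coordinates S) by apply: countableU; exact: cI.
have cA' : countable (x |` coordinates S).
  by apply: countableU => //; exact: countable1.
by apply: countableU; apply: cI; apply: countableX => //; exact: countableX.
Qed.

(** Only finitely many prefixes of length [k] exist. *)
Lemma infinite_agree (A : set T) (k : nat) : infinite_set A ->
  (forall p q, A p -> A q -> p.2 = q.2 -> p = q) ->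
  exists p q, [/\ A p, A q, p.2 <> q.2 & forall i, (i < k)%N -> p.2 i = q.2 i].
Proof.
move=> infA iA; apply: contrapT => h; apply: infA.
pose f (p : T) : {ffun 'I_k -> bool} := [ffun i : 'I_k => p.2 i].
have injf : {in A &, injective f}.
  move=> p q /set_mem Ap /set_mem Aq /ffunP fpq.
  apply: contrapT => pq; apply: h; exists p, q; split=> //.
    by move=> e; apply: pq; exact: iA.
  by move=> i ik; have := fpq (Ordinal ik); rewrite !ffunE.
by rewrite -(eq_finite_set (inj_card_eq injf)); exact: finite_finset.
Qed.

End Grid.

Lemma infinite_set_seq {T : Type} {A : set T} : infinite_set A ->
  exists2 a : nat -> T, injective a & forall i, A (a i).
Proof.
move=> /infiniteP/card_leP[f].
exists (fun n => \val (f (SigSub (mem_set (I : [set: nat] n))))).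
  move=> i j /val_inj /(@inj _ _ _ f); rewrite !in_setT => /(_ isT isT).
  by move=> /(congr1 \val).
by move=> i; apply: set_mem; exact: valP.
Qed.

(** * Continuity of the convolution *)

Section Necessity.
Context {R : realType} {E1 E2 F : tvsType R} (b : {bilinear E1 -> E2 -> F}).
Context {G : groupType} (lam : R) (lam_gt0 : 0 < lam).
Hypothesis cb :
  continuous (fun p : dsum G E1 * dsum G E2 => bconv b lam p.1 p.2).

(** Distinct products [g i * h j] let the seminorm [p i j] alone define the
    target neighbourhood at [g i * h j]; a bound of [lam *: b] on products of unit
    balls is then a product estimate by homogeneity. *)
Lemma bconv_continuous_product_estimates : infinite_set [set: G] ->
  product_estimates b.
Proof.
move=> infG p cp.
have [S [[gS _] finS _]] := @exists_large_grid G.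
have [a inja Sa] := infinite_set_seq (fun fS => infG (finS fS)).
pose g i := (a i).1.1; pose h j := (a j).1.2.
have /choice[q Hq] (k : G) : exists q : F -> R, continuous_seminorm q /\
    forall i j, (g i * h j)%g = k -> q = p i j.
  have [[[i j] /= ijk]|h0] := pselect (exists ij, (g ij.1 * h ij.2)%g = k).
    exists (p i j); split=> // i' j'; rewrite -ijk => e.
    have [/inja -> /inja -> //] := gS _ _ _ _ (Sa i') (Sa j') (Sa i) (Sa j) e.
  exists (fun x => 0 * p 0 0 x); split.
    exact: continuous_seminorm_scale.
  by move=> i j e; case: h0; exists (i, j).
have nV := dsum_nbhs0_box _ _ _ q (fun k => (Hq k).1).
have [W1 [W2 [[_ [_ nW1]] [_ [_ nW2]] WV]]] := bconv_continuous_nbhs0 _ _ _ nV cb.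
have /choice[p1 Hp1] (i : nat) : exists p1 : E1 -> R, continuous_seminorm p1 /\
    forall x, p1 x < 1 -> W1 (dsum_in (g i) x).
  by have [p1 c1 W] := seminorm_in_nbhs0 _ _ _ (nW1 (g i)); exists p1.
have /choice[p2 Hp2] (j : nat) : exists p2 : E2 -> R, continuous_seminorm p2 /\
    forall y, p2 y < 1 -> W2 (dsum_in (h j) y).
  by have [p2 c2 W] := seminorm_in_nbhs0 _ _ _ (nW2 (h j)); exists p2.
exists (fun i x => lam^-1 * p1 i x), p2; split=> [i|j|i j x y].
- by apply: continuous_seminorm_scale; [rewrite invr_ge0 ltW|case: (Hp1 i)].
- by case: (Hp2 j).
have [c1 W1x] := Hp1 i; have [c2 W2y] := Hp2 j; have [sp _] := cp i j.
rewrite -mulrA -ler_pdivrMl ?invr_gt0// invrK.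
(* Any [s > p1 x] and [t > p2 y] bring [x / s] and [y / t] into the unit balls. *)
have bnd s t : p1 i x < s -> p2 j y < t -> lam * p i j (b x y) <= s * t.
  move=> xs yt.
  have s0 : 0 < s := le_lt_trans (seminorm_ge0 _ c1.1 x) xs.
  have t0 : 0 < t := le_lt_trans (seminorm_ge0 _ c2.1 y) yt.
  have /W1x Wx : p1 i (s^-1 *: x) < 1.
    by rewrite (seminormZ _ c1.1) gtr0_norm ?invr_gt0// ltr_pdivrMl// mulr1.
  have /W2y Wy : p2 j (t^-1 *: y) < 1.
    by rewrite (seminormZ _ c2.1) gtr0_norm ?invr_gt0// ltr_pdivrMl// mulr1.
  have := WV _ _ Wx Wy; rewrite bconv_in => /(_ (g i * h j)%g).
  have [_ /(_ i j erefl) ->] := Hq (g i * h j)%g.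
  rewrite dsum_inE eqxx linearZl linearZr/= !(seminormZ _ sp).
  rewrite !gtr0_norm ?invr_gt0// => /ltW.
  by rewrite mulrCA ler_pdivrMl// mulr1 mulrCA ler_pdivrMl// [t * s]mulrC.
apply/ler_addgt0Pr => e e0.
(* The error of [(p1 x + d) * (p2 y + d)] is [d * (p1 x + p2 y + d) <= d * K]. *)
pose K := p1 i x + p2 j y + 1.
have x0 := seminorm_ge0 _ c1.1 x; have y0 := seminorm_ge0 _ c2.1 y.
have K0 : 0 < K by rewrite /K; lra.
pose d := Num.min 1 (e / K).
have d0 : 0 < d by rewrite lt_min ltr01 divr_gt0.
have d1 : d <= 1 by rewrite ge_min lexx.
have dK : d * K <= e by rewrite -ler_pdivlMr// ge_min lexx orbT.
apply: le_trans (bnd (p1 i x + d) (p2 j y + d) _ _) _; rewrite ?ltrDl//.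
apply: le_trans (_ : p1 i x * p2 j y + d * K <= _); last by rewrite lerD2l.
have : d * d <= d * 1 by rewrite ler_wpM2l// ltW.
rewrite /K; nra.
Qed.

(** Were [G] uncountable, some scale [1 / n.+1] would bring the multiples of
    [x0] and [y0] into the given neighbourhoods at infinitely many places of a
    large grid; two of these have labels with an arbitrarily long common prefix,
    and the target neighbourhood is chosen to shrink along such pairs. *)
Lemma bconv_continuous_countable (x0 : E1) (y0 : E2) :
  hausdorff_space F -> b x0 y0 <> 0 -> countable [set: G].
Proof.
move=> hF bxy.
have [p cp p0] := seminorm_separates _ _ _ hF bxy.
have [S [[gS iS] _ cS]] := @exists_large_grid G.
apply: cS; apply: contrapT => ncS.
pose agree k (s t : nat -> bool) := forall i, (i < k)%N -> s i = t i.
(* At [s.1.1 * t.1.2] the factor is an index [N] at which the labels of [s] and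
   [t] differ: it bounds the length of every common prefix. *)
have /choice[q Hq] (k : G) : exists q : F -> R, continuous_seminorm q /\
    forall s t m, S s -> S t -> s.2 <> t.2 -> agree m s.2 t.2 ->
      (s.1.1 * t.1.2)%g = k -> forall e, m%:R * p e <= q e.
  have [[[s t] /= [Ss St st stk]]|h0] := pselect (exists st, [/\ S st.1, S st.2,
      st.1.2 <> st.2.2 & (st.1.1.1 * st.2.1.2)%g = k]).
    have [N sN] : exists N, s.2 N <> t.2 N.
      by apply/existsNP => e; apply: st; apply/funext.
    exists (fun x => N%:R * p x); split; first exact: continuous_seminorm_scale.
    move=> s' t' m Ss' St' st' ag e x.
    have [es et] : s' = s /\ t' = t by apply: gS; rewrite ?e.
    rewrite ler_wpM2r ?(seminorm_ge0 _ cp.1)// ler_nat leqNgt.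
    by apply/negP => Nm; apply: sN; rewrite -es -et; exact: ag.
  exists (fun x => 0 * p x); split; first exact: continuous_seminorm_scale.
  by move=> s t m Ss St st ag e; case: h0; exists (s, t).
have nV := dsum_nbhs0_box _ _ _ q (fun k => (Hq k).1).
have [W1 [W2 [[_ [_ nW1]] [_ [_ nW2]] WV]]] := bconv_continuous_nbhs0 _ _ _ nV cb.
pose A n := [set s | [/\ S s, W1 (dsum_in s.1.1 (n.+1%:R^-1 *: x0)) &
  W2 (dsum_in s.1.2 (n.+1%:R^-1 *: y0))]].
have [n infA] : exists n, infinite_set (A n).
  apply/existsNP => finA; apply: ncS.
  apply: (@sub_countable _ _ _ (\bigcup_n A n)); last first.
    by apply: bigcup_countable => // n _; exact: finite_set_countable.
  apply: subset_card_le => s Ss.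
  have : \forall t \near (0 : R^o),
      W1 (dsum_in s.1.1 (t *: x0)) /\ W2 (dsum_in s.1.2 (t *: y0)).
    by apply: filterI;
      [exact: nbhs0_absorb (nW1 _)|exact: nbhs0_absorb (nW2 _)].
  move=> /cvg_harmonic[N _ /(_ N)] /= /(_ (leqnn N)) [w1 w2].
  by exists N.
pose c := lam * n.+1%:R^-1 * n.+1%:R^-1 * p (b x0 y0).
have c0 : 0 < c by rewrite !mulr_gt0// invr_gt0.
have [m cm] : exists m : nat, 1 <= m%:R * c.
  exists (Num.bound c^-1); rewrite -ler_pdivrMr// mul1r ltW//.
  by rewrite archi_boundP// invr_ge0 ltW.
have [s [t [[Ss W1s _] [St _ W2t] st ag]]] := infinite_agree (A n) m infA
  (fun s t As At => iS s t (let: And3 Ss _ _ := As in Ss)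
    (let: And3 St _ _ := At in St)).
have := WV _ _ W1s W2t; rewrite bconv_in => /(_ (s.1.1 * t.1.2)%g).
rewrite dsum_inE eqxx linearZl linearZr/= => qlt1.
have [_ /(_ s t m Ss St st ag erefl) le] := Hq (s.1.1 * t.1.2)%g.
have := le_lt_trans (le _) qlt1.
rewrite !(seminormZ _ cp.1) !gtr0_norm ?invr_gt0// 2!mulrA -/c => mc1.
by have := lt_le_trans mc1 cm; rewrite ltxx.
Qed.

End Necessity.

Section Sufficiency.
Context {R : realType} {E1 E2 F : tvsType R} (b : {bilinear E1 -> E2 -> F}).
Context {G : groupType} (lam : R) (lam_gt0 : 0 < lam).

(** With the places enumerated by [f], the product estimates allow to take
    independent weights in the two factors, among them the weights [2 ^- k.+1]
    that make the convolution a convex combination of elements of [V]. *)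
Lemma product_estimates_bconv_continuous :
  countable [set: G] -> product_estimates b ->
  continuous (fun p : dsum G E1 * dsum G E2 => bconv b lam p.1 p.2).
Proof.
move=> /countable_injP[f injf'] pe; apply: nbhs0_bconv_continuous => V nV.
have injf : injective f by move=> x y; apply: injf'; rewrite inE.
have [cV [V0 nVg]] := nV.
have /choice[q Hq] (k : G) : exists q : F -> R, continuous_seminorm q /\
    forall e, q e < 1 -> V (dsum_in k e).
  by have [q c W] := seminorm_in_nbhs0 _ _ _ (nVg k); exists q.
have /choice[finv fK] (i : nat) : exists h,
    (exists g, f g = i) -> f h = i.
  have [[g fg]|ng] := pselect (exists g, f g = i); first by exists g.
  by exists 1%g => /ng.
have {}fK g : finv (f g) = g by apply/injf/fK; exists g.
have [p1 [p2 [cp1 cp2 p12]]] :=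
  pe (fun i j => q (finv i * finv j)%g) (fun i j => (Hq _).1).
pose r1 g x := (lam * 2 ^+ (f g).+1) * p1 (f g) x.
pose r2 h y := 2 ^+ (f h).+1 * p2 (f h) y.
exists [set u | forall g, r1 g (u g) < 1], [set v | forall h, r2 h (v h) < 1].
split.
- apply: dsum_nbhs0_box => g; apply: continuous_seminorm_scale => //.
  by rewrite mulr_ge0 ?exprn_ge0// ltW.
- by apply: dsum_nbhs0_box => h; exact: continuous_seminorm_scale.
move=> u v /= ru rv; rewrite bconv_decomp.
pose w g : R := 2 ^- (f g).+1.
have wn0 g : 2 ^+ (f g).+1 != 0 :> R by rewrite expf_neq0.
pose X g h := dsum_in (g * h)%g
  (2 ^+ (f h).+1 *: (2 ^+ (f g).+1 *: (lam *: b (u g) (v h)))).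
have XV g h : V (X g h).
  have [cq qV] := Hq (g * h)%g; apply: qV.
  rewrite !(seminormZ _ cq.1) !ger0_norm ?exprn_ge0 ?(ltW lam_gt0)//.
  have := p12 (f g) (f h) (u g) (v h); rewrite !fK => le.
  apply: le_lt_trans (_ : r1 g (u g) * r2 h (v h) < 1).
    rewrite /r1 /r2 [leRHS]mulrCA ler_wpM2l// [lam * _]mulrC -!mulrA ler_wpM2l//.
    by rewrite ler_wpM2l// ltW.
  have r1_ge0 : 0 <= r1 g (u g).
    by rewrite /r1 !mulr_ge0 ?exprn_ge0 ?(ltW lam_gt0) ?(seminorm_ge0 _ (cp1 _).1).
  have r2_ge0 : 0 <= r2 h (v h).
    by rewrite /r2 !mulr_ge0 ?exprn_ge0 ?(seminorm_ge0 _ (cp2 _).1).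
  by rewrite mulr_ilt1.
have -> : \sum_(y <- finsupp u) \sum_(z <- finsupp v)
    dsum_in (y * z)%g (lam *: b (u y) (v z)) =
    \sum_(y <- finsupp u) w y *: \sum_(z <- finsupp v) w z *: X y z.
  apply: eq_bigr => y _; rewrite scaler_sumr; apply: eq_bigr => z _.
  by rewrite -!dsum_inZ !scalerK.
have w0 g : 0 <= w g by rewrite invr_ge0 exprn_ge0.
have w1 (s : {fset G}) : \sum_(g <- s) w g < 1.
  exact: sum_geometric_lt1.
by apply: sum_convex_lt1 => // y; exact: sum_convex_lt1.
Qed.

End Sufficiency.

Theorem proposition6p1 (R : realType) (E1 E2 F : tvsType R)
    (hE1 : hausdorff_space E1) (hE2 : hausdorff_space E2)
    (hF : hausdorff_space F)
    (b : {bilinear E1 -> E2 -> F})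
    (b_cont : continuous (fun p : E1 * E2 => b p.1 p.2))
    (b_neq0 : ~ (forall x y, b x y = 0))
    (G : groupType) (G_infinite : infinite_set [set: G])
    (lam : R) (lam_gt0 : 0 < lam) :
  continuous (fun p : dsum G E1 * dsum G E2 => bconv b lam p.1 p.2) <->
  countable [set: G] /\ product_estimates b.
Proof.
split=> [cb|[cG pe]]; last exact: product_estimates_bconv_continuous.
split; last exact: bconv_continuous_product_estimates cb G_infinite.
have /existsNP[x0 /existsNP[y0 bxy]] := b_neq0.
exact: bconv_continuous_countable cb x0 y0 hF bxy.
Qed.
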